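(* There is an algorithm which, given a path $P$ of length $n$ and a sequential function $f$, decides in time $O(n)$ whether the position of Sequential $2$-coloring on $P$ with sequential function $f$ (with all vertices uncolored) is a $\mathcal{P}$-position or an $\mathcal{N}$-position.
   Context: The length of a path is its number of vertices. For a graph with vertex set $V$, $|V|=n$, a sequential function is a bijection $f:\{1,\dots,n\}\to V$. Sequential $2$-coloring: two players alternate turns; on the $i$-th turn the current player must color the vertex $f(i)$ with one of two colors so that no two adjacent vertices have the same color (so the first player colors the vertices $f(1),f(3),\dots$ and the second player $f(2),f(4),\dots$). A player unable to make a legal move on their turn, either because $f(i)$ cannot be properly colored or because all vertices are already colored, loses. A position is a $\mathcal{P}$-position if the second player has a winning strategy, and an $\mathcal{N}$-position otherwise. Running time is measured as the number of elementary operations, with arithmetic on integers up to $n$ and array accesses counted as one operation. *)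

(* Defs.v *)
From mathcomp Require Import all_boot.

Set Implicit Arguments.
Unset Strict Implicit.
Unset Printing Implicit Defensive.

(** * Sequential 2-coloring *)

(* Turns and vertices on the path are numbered from 0, so the first player
   moves at the even turns and the second player at the odd turns. *)

Section Game.

Variables (n : nat) (V : finType) (e : rel V) (f : 'I_n -> V).

Definition path_graph : Prop :=
  exists2 p : 'I_n -> V, bijective p
    & forall i j : 'I_n, e (p i) (p j) = (j == i.+1 :> nat) || (i == j.+1 :> nat).

(* A history [h : seq bool] lists the colors given so far: the j-th vertex of
   the sequential function has color [nth false h j] for [j < size h], all other
   vertices are uncolored, and the turn to be played is number [size h]. *)

Definition legal (h : seq bool) (c : bool) : bool :=
  [exists i : 'I_n, (i == size h :> nat) &&
    [forall j : 'I_n, (j < i) && e (f i) (f j) ==> (nth false h j != c)]].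

Definition stuck (h : seq bool) : Prop := forall c, ~~ legal h c.

Definition legal_play (h : seq bool) : Prop :=
  forall k, k < size h -> legal (take k h) (nth false h k).

Definition strategy2 (s : seq bool -> bool) : Prop :=
  forall h, legal_play h -> odd (size h) -> ~ stuck h -> legal h (s h).

Definition follows2 (s : seq bool -> bool) (h : seq bool) : Prop :=
  forall k, k < size h -> odd k -> nth false h k = s (take k h).

(* The player to move in a stuck position loses; a play has at most [n] moves,
   hence always reaches a stuck position. *)
Definition winning2 (s : seq bool -> bool) : Prop :=
  forall h, legal_play h -> follows2 s h -> stuck h -> ~~ odd (size h).

Definition P_position : Prop := exists s, strategy2 s /\ winning2 s.

Definition N_position : Prop := ~ P_position.

End Game.

(** * A random access machine with bounded integers *)

(* Programs use integer variables and integer arrays, both named by natural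
   numbers (a given program mentions finitely many of them).  The semantics is
   parameterized by a bound [W]: a computation that produces an integer above
   [W], or uses an array index above [W], has no execution.  Every constant,
   variable access, array access, arithmetic operation, assignment and test
   costs one unit of time. *)

Inductive binop := OpAdd | OpSub | OpMul | OpDiv | OpMod | OpEq | OpLt.

Inductive expr :=
  | Const of nat
  | Var of nat
  | Get of nat & expr              (* array, index *)
  | Op of binop & expr & expr.

Inductive cmd :=
  | Skip
  | Assign of nat & expr           (* variable, value *)
  | Put of nat & expr & expr       (* array, index, value *)
  | Seq of cmd & cmd
  | If of expr & cmd & cmd
  | While of expr & cmd.

Record state := State { var : nat -> nat; arr : nat -> nat -> nat }.

Definition upd (T : Type) (g : nat -> T) (x : nat) (v : T) : nat -> T :=
  fun y => if y == x then v else g y.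

Definition set_var (s : state) (x v : nat) : state :=
  State (upd (var s) x v) (arr s).

Definition set_arr (s : state) (a i v : nat) : state :=
  State (var s) (upd (arr s) a (upd (arr s a) i v)).

Definition eval_op (o : binop) (x y : nat) : nat :=
  match o with
  | OpAdd => x + y
  | OpSub => x - y
  | OpMul => x * y
  | OpDiv => x %/ y
  | OpMod => x %% y
  | OpEq => x == y
  | OpLt => x < y
  end.

Definition guard (W v : nat) : option nat := if v <= W then Some v else None.

Fixpoint eval (W : nat) (s : state) (t : expr) : option nat :=
  match t with
  | Const k => guard W k
  | Var x => guard W (var s x)
  | Get a t1 => obind (fun i => guard W (arr s a i)) (eval W s t1)
  | Op o t1 t2 =>
      obind (fun x => obind (fun y => guard W (eval_op o x y)) (eval W s t2))
            (eval W s t1)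
  end.

Fixpoint cost (t : expr) : nat :=
  match t with
  | Const _ | Var _ => 1
  | Get _ t1 => (cost t1).+1
  | Op _ t1 t2 => (cost t1 + cost t2).+1
  end.

(* [exec W c s s' t]: started in [s], the program [c] halts in [s'] after
   [t] elementary operations. *)
Inductive exec (W : nat) : cmd -> state -> state -> nat -> Prop :=
  | ExecSkip s : exec W Skip s s 1
  | ExecAssign s x t v :
      eval W s t = Some v ->
      exec W (Assign x t) s (set_var s x v) (cost t).+1
  | ExecPut s a ti tv i v :
      eval W s ti = Some i -> eval W s tv = Some v ->
      exec W (Put a ti tv) s (set_arr s a i v) (cost ti + cost tv).+1
  | ExecSeq s s1 s2 c1 c2 t1 t2 :
      exec W c1 s s1 t1 -> exec W c2 s1 s2 t2 ->
      exec W (Seq c1 c2) s s2 (t1 + t2)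
  | ExecIfTrue s s' b c1 c2 v t :
      eval W s b = Some v -> v != 0 -> exec W c1 s s' t ->
      exec W (If b c1 c2) s s' (cost b + t).+1
  | ExecIfFalse s s' b c1 c2 t :
      eval W s b = Some 0 -> exec W c2 s s' t ->
      exec W (If b c1 c2) s s' (cost b + t).+1
  | ExecWhileTrue s s1 s2 b c v t1 t2 :
      eval W s b = Some v -> v != 0 ->
      exec W c s s1 t1 -> exec W (While b c) s1 s2 t2 ->
      exec W (While b c) s s2 (cost b + t1 + t2).+1
  | ExecWhileFalse s b c :
      eval W s b = Some 0 ->
      exec W (While b c) s s (cost b).+1.

(** * Input and output *)

(* [E] lists every edge of the graph exactly once, in arbitrary order and with
   arbitrary orientation; the boolean [e u v] is read as 0 or 1. *)
Definition edge_list (V : finType) (e : rel V) (E : seq (V * V)) : Prop :=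
  forall u v : V, count_mem (u, v) E + count_mem (v, u) E = e u v.

(* Variable 0 holds [n], array 0 the sequential function, arrays 1 and 2 the
   two endpoints of the listed edges; everything else is 0. *)
Definition input (n : nat) (f : 'I_n -> 'I_n) (E : seq ('I_n * 'I_n)) : state :=
  State (fun x => if x is 0 then n else 0)
        (fun a => nth 0 (match a with
                         | 0 => [seq val (f i) | i <- enum 'I_n]
                         | 1 => [seq val x.1 | x <- E]
                         | 2 => [seq val x.2 | x <- E]
                         | _ => [::]
                         end)).

Definition output (s : state) : nat := var s 0.

(* Main.v *)
Require Import Defs.
From mathcomp Require Import all_boot zify.

Set Implicit Arguments.
Unset Strict Implicit.
Unset Printing Implicit Defensive.

(** At any time the colored vertices form disjoint intervals of the path.  In
    each interval the coloring is one of the two proper ones, so a single bit,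
    the shade, describes it; the shade is chosen freely when the first vertex
    of the interval is colored, and the turn of that choice is the birth of the
    interval.  A turn whose vertex has two colored neighbors merges two
    intervals.  It is possible exactly when their shades agree, and then the
    merged interval inherits the smaller birth [elder k]; the larger birth
    [younger k] dies at turn [k].  Thus each birth dies at most once, and the
    schedule of births and deaths depends on the sequential function alone.

    The player who made the younger choice [younger k] knew the shade of the
    elder interval, hence controls whether turn [k] is possible, provided that
    all earlier merges went through.  That player is happy to let the merge
    happen if turn [k] is also theirs, that is if [younger k] and [k] have the same
    parity, and wants to block it otherwise.  Let [mismatch] be the first turn
    at which the parities differ, or [n] if there is none.  The opponent of the
    player of turn [mismatch] wins: always agree with the elder interval, except
    at the birth that dies at turn [mismatch], where the shades are made to
    differ.  By induction no turn of the winner before [mismatch] is blocked,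
    and turn [mismatch] is impossible if it is ever reached.  So the position is
    a P-position if and only if [mismatch] is even ([P_positionE]).

    To compute [mismatch] in linear time, each interval is represented at its
    two ends only, where its opposite end and its birth are stored; coloring a
    vertex then changes a bounded number of array cells ([intervals_step]).
    The neighbors of a vertex are found by one pass through the list of edges;
    their order does not matter, as a merge treats both sides alike. *)

(** * Merging intervals of colored vertices *)

(** Positions on the path are counted from 1, and [tau q] is the turn at which
    position [q] gets its color.  The value [n] or more outside 1, ..., n makes
    both ends of the path look like vertices that are never colored, so that a
    missing neighbor needs no separate treatment. *)
Record timing (n : nat) (pos tau : nat -> nat) : Prop := Timing {
  posK : forall t, t < n -> tau (pos t) = t;
  tauK : forall q, tau q < n -> pos (tau q) = q;
  tau_left : n <= tau 0;
  tau_right : forall q, n < q -> n <= tau q }.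

Section Persistence.

Variables (n : nat) (pos tau : nat -> nat).
Hypothesis tim : timing n pos tau.

(** Before turn [k], positions [x] and [y] lie in the same colored interval. *)
Definition linked k x y : bool :=
  all (fun q => tau q < k) (iota (minn x y) (maxn x y - minn x y).+1).

Definition birth k x : nat := find (fun u => linked k (pos u) x) (iota 0 n).

(** The cut at [k] lets the vertex colored at turn [k] count as an interval
    born at [k] on each side where it has no colored neighbor.  Then [younger k]
    and [elder k] make sense at every turn, and [younger k = k] unless turn [k]
    merges two intervals. *)
Definition side k q : nat := minn k (birth k q).
Definition younger k : nat := maxn (side k (pos k).-1) (side k (pos k).+1).
Definition elder k : nat := minn (side k (pos k).-1) (side k (pos k).+1).

Definition death j : nat := find (fun k => birth k.+1 (pos j) < j) (iota 0 n).

Definition mismatch : nat :=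
  find (fun k => odd (younger k) != odd k) (iota 0 n).

Lemma linkedP k x y :
  reflect (forall q, minn x y <= q <= maxn x y -> tau q < k) (linked k x y).
Proof.
apply: (iffP allP) => H q; first by move=> ?; apply: H; rewrite mem_iota; lia.
by rewrite mem_iota => ?; apply: H; lia.
Qed.

Lemma linkedxx k x : linked k x x = (tau x < k).
Proof. by apply/linkedP/idP => [|tx q ?]; [apply; lia | have -> : q = x by lia]. Qed.

Lemma linked_sym k x y : linked k x y = linked k y x.
Proof. by rewrite /linked minnC maxnC. Qed.

Lemma linked_trans k y x z : linked k x y -> linked k y z -> linked k x z.
Proof.
move=> /linkedP xy /linkedP yz; apply/linkedP => q ?.
have [?|?] : minn x y <= q <= maxn x y \/ minn y z <= q <= maxn y z by lia.
- exact: xy.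
- exact: yz.
Qed.

Lemma linked_mono k k' x y : k <= k' -> linked k x y -> linked k' x y.
Proof. by move=> kk' /linkedP H; apply/linkedP => q /H; lia. Qed.

Lemma linkedl k x y : linked k x y -> tau x < k.
Proof. by move=> /linkedP; apply; lia. Qed.

Lemma linkedr k x y : linked k x y -> tau y < k.
Proof. by rewrite linked_sym; apply: linkedl. Qed.

Lemma linked_next k x y : y = x.+1 -> tau x < k -> tau y < k -> linked k x y.
Proof.
by move=> -> tx ty; apply/linkedP => q ?; have [->|->] : q = x \/ q = x.+1 by lia.
Qed.

Lemma tau_pos_eq k q : k < n -> tau q = k -> q = pos k.
Proof. by move=> kn tq; rewrite -tq (tauK tim) // tq. Qed.

Lemma pos_gt0 k : k < n -> 0 < pos k.
Proof. by move=> kn; case E: (pos k) => //; have := tau_left tim; rewrite -E (posK tim) // leqNgt kn. Qed.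

(** Turn [k] adds the single vertex [pos k], so every new link passes through
    it. *)
Lemma linked_succ k x y : k < n ->
  linked k.+1 x y -> linked k x y \/ (linked k.+1 x (pos k) /\ linked k.+1 (pos k) y).
Proof.
move=> kn /linkedP H.
have [inside|outside] := boolP (minn x y <= pos k <= maxn x y).
  by right; split; apply/linkedP => q ?; apply: H; lia.
left; apply/linkedP => q qI.
have := H q qI; rewrite ltnS leq_eqVlt => /orP[/eqP tq|//].
by move: outside; rewrite -(tau_pos_eq kn tq) qI.
Qed.

Lemma linked_new k x : k < n -> linked k.+1 x (pos k) ->
  [\/ x = pos k, linked k x (pos k).-1 | linked k x (pos k).+1].
Proof.
move=> kn /linkedP H; have p0 := pos_gt0 kn.
have K q : minn x (pos k) <= q <= maxn x (pos k) -> q != pos k -> tau q < k.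
  move=> qI nq; have := H q qI; rewrite ltnS leq_eqVlt => /orP[/eqP tq|//].
  by rewrite (tau_pos_eq kn tq) eqxx in nq.
have [lt|gt|->] := ltngtP x (pos k); last by constructor 1.
- by constructor 2; apply/linkedP => q ?; apply: K; lia.
- by constructor 3; apply/linkedP => q ?; apply: K; lia.
Qed.

Lemma linked_pred_new k : k < n -> tau (pos k).-1 < k -> linked k.+1 (pos k).-1 (pos k).
Proof.
move=> kn tq; apply: linked_next; rewrite ?(posK tim kn) //; last exact: ltnW.
by rewrite prednK ?pos_gt0.
Qed.

Lemma linked_succ_new k : k < n -> tau (pos k).+1 < k -> linked k.+1 (pos k).+1 (pos k).
Proof.
by move=> kn tq; rewrite linked_sym; apply: linked_next; rewrite ?(posK tim kn) //; exact: ltnW.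
Qed.

(** The path is acyclic: the two intervals merged by a turn are distinct. *)
Lemma not_linked_across k : k < n -> ~~ linked k (pos k).-1 (pos k).+1.
Proof.
move=> kn; apply/negP => /linkedP /(_ (pos k)); rewrite (posK tim) // ltnn.
by move=> H; have := pos_gt0 kn; lia.
Qed.

Lemma birth_le k x u : u < n -> linked k (pos u) x -> birth k x <= u.
Proof.
move=> un lu; rewrite leqNgt; apply/negP => lt.
by have := before_find 0 lt; rewrite nth_iota // add0n lu.
Qed.

Lemma birth_link k x : k <= n -> tau x < k -> linked k (pos (birth k x)) x.
Proof.
move=> kn tx; have txn : tau x < n by lia.
have hx : has (fun u => linked k (pos u) x) (iota 0 n).
  apply/hasP; exists (tau x); first by rewrite mem_iota; lia.
  by rewrite (tauK tim) // linkedxx.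
have := nth_find 0 hx; rewrite nth_iota ?add0n //.
by move: hx; rewrite has_find size_iota.
Qed.

Lemma birth_lt k x : k <= n -> tau x < k -> birth k x < k.
Proof.
move=> kn tx; apply: leq_ltn_trans (tx); apply: birth_le; first by lia.
by rewrite (tauK tim) ?linkedxx //; lia.
Qed.

Lemma birth_blank k x : k <= n -> k <= tau x -> k <= birth k x.
Proof.
move=> kn tx; rewrite leqNgt; apply/negP => lt.
have : has (fun u => linked k (pos u) x) (iota 0 n).
  by rewrite has_find size_iota; apply: leq_trans lt kn.
by case/hasP => u _ /linkedr; rewrite ltnNge tx.
Qed.

Lemma side_lt k x : k <= n -> (side k x < k) = (tau x < k).
Proof.
move=> kn; rewrite /side; case: (ltnP (tau x) k) => tx.
  by have := birth_lt kn tx; lia.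
by have := birth_blank kn tx; lia.
Qed.

Lemma side_birth k x : k <= n -> tau x < k -> side k x = birth k x.
Proof. by move=> kn tx; have := birth_lt kn tx; rewrite /side; lia. Qed.

Lemma side_blank k x : k <= n -> k <= tau x -> side k x = k.
Proof. by move=> kn tx; have := birth_blank kn tx; rewrite /side; lia. Qed.

Lemma birth_anti k k' x : k <= k' -> birth k' x <= birth k x.
Proof.
move=> kk'; apply: sub_find => u; exact: linked_mono.
Qed.

Lemma birth_linked k x y : linked k x y -> birth k x = birth k y.
Proof.
move=> xy; apply: eq_find => u; apply/idP/idP => ux; apply: linked_trans ux _ => //.
by rewrite linked_sym.
Qed.

Lemma birth_idem k x : k <= n -> tau x < k -> birth k (pos (birth k x)) = birth k x.
Proof. by move=> kn tx; apply: birth_linked; apply: birth_link. Qed.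

(** The elder rule: the interval formed at turn [k] keeps the smallest birth
    among its parts. *)
Lemma birth_new k x : k < n -> linked k.+1 x (pos k) -> birth k.+1 x = elder k.
Proof.
move=> kn lx; rewrite (birth_linked lx); apply/eqP; rewrite eqn_leq; apply/andP; split.
- have sideP q : linked k.+1 q (pos k) \/ k <= tau q -> birth k.+1 (pos k) <= side k q.
    case: (ltnP (tau q) k) => tq H.
      case: H => [lq|]; last by lia.
      by rewrite side_birth ?(ltnW kn) // -(birth_linked lq) birth_anti.
    rewrite side_blank ?(ltnW kn) //; apply: birth_le => //.
    by rewrite linkedxx (posK tim).
  rewrite /elder leq_min; apply/andP; split; apply: sideP.
  + by case: (ltnP (tau (pos k).-1) k) => ?; [left; apply: linked_pred_new | right].
  + by case: (ltnP (tau (pos k).+1) k) => ?; [left; apply: linked_succ_new | right].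
- have tk : tau (pos k) < k.+1 by rewrite (posK tim).
  have rlt := birth_lt kn tk.
  have rn : birth k.+1 (pos k) < n by lia.
  case: (linked_new kn (birth_link kn tk)) => H.
  + have := posK tim rn; rewrite H (posK tim kn) => <-.
    by rewrite /elder /side; lia.
  + by have := birth_le rn H; rewrite /elder /side; lia.
  + by have := birth_le rn H; rewrite /elder /side; lia.
Qed.

Lemma birth_old k x : k < n -> tau x < k.+1 -> ~~ linked k.+1 x (pos k) -> birth k.+1 x = birth k x.
Proof.
move=> kn tx nx; apply: eq_find => u /=; apply/idP/idP; last by apply: linked_mono; lia.
case/(linked_succ kn) => // -[_]; rewrite linked_sym => xk.
by rewrite xk in nx.
Qed.

(** At turn [k] the interval of [x] is joined to a strictly older one, so its
    birth is no longer the least of its interval, while until then it was. *)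
Lemma death_birth k x : k < n -> tau x < k -> linked k.+1 x (pos k) ->
  elder k < birth k x ->
  death (birth k x) = k /\ birth k.+1 (pos (birth k x)) = elder k.
Proof.
move=> kn tx lx lt; have kn' := ltnW kn; set j := birth k x.
have rj : birth k.+1 (pos j) = elder k.
  by rewrite birth_new // (linked_trans (linked_mono (leqnSn k) (birth_link kn' tx))).
split=> //; apply/eqP; rewrite eqn_leq; apply/andP; split; rewrite leqNgt; apply/negP => H.
  by have := before_find 0 H; rewrite nth_iota // add0n rj lt.
have hj : has (fun k => birth k.+1 (pos j) < j) (iota 0 n).
  by rewrite has_find size_iota; apply: ltn_trans H kn.
have := nth_find 0 hj; rewrite nth_iota -?/(death j) ?(ltn_trans H) // add0n ltnNge.
by rewrite -{1}(birth_idem kn' tx : birth k (pos j) = j) birth_anti.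
Qed.

(** What a merge says about the schedule: it is the unique turn at which the
    younger birth dies, and it is the elder birth that takes over.  This lets a
    player read off, at his turn [younger k], both [k] and [elder k]. *)
Lemma younger_dies k : k < n -> younger k < k ->
  [/\ elder k < younger k, death (younger k) = k,
      birth k.+1 (pos (younger k)) = elder k &
      (linked k (pos (elder k)) (pos k).-1 /\ linked k (pos (younger k)) (pos k).+1) \/
      (linked k (pos (elder k)) (pos k).+1 /\ linked k (pos (younger k)) (pos k).-1)].
Proof.
move=> kn; have kn' := ltnW kn; set q := pos k.
rewrite gtn_max !side_lt // => /andP[tl tr].
have Ll := birth_link kn' tl; have Lr := birth_link kn' tr.
have ne : birth k q.-1 != birth k q.+1.
  apply: contraNneq (not_linked_across kn) => E.
  by rewrite E in Ll; apply: linked_trans Lr; rewrite linked_sym.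
have [[eE eY]|[eE eY]] : (elder k = birth k q.-1 /\ younger k = birth k q.+1) \/
      (elder k = birth k q.+1 /\ younger k = birth k q.-1).
- by rewrite /elder /younger !side_birth // -/q; lia.
all: have lt : elder k < younger k by
  rewrite eE eY; move: ne eE eY; rewrite /elder /younger !side_birth // -/q; lia.
- have [|dY rY] := death_birth kn tr (linked_succ_new kn tr); first by rewrite -eY.
  rewrite -eY in dY rY; split=> //.
  by left; rewrite eE eY.
- have [|dY rY] := death_birth kn tl (linked_pred_new kn tl); first by rewrite -eY.
  rewrite -eY in dY rY; split=> //.
  by right; rewrite eE eY.
Qed.

Definition adjacent (x y : nat) : bool := (y == x.+1) || (x == y.+1).

Lemma adjacent_linked k x y : adjacent x y -> tau x < k -> tau y < k -> linked k x y.
Proof.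
by case/orP => /eqP E tx ty; [|rewrite linked_sym]; apply: linked_next.
Qed.

(** A vertex with a colored neighbor joins that older interval at once.  So a
    choice that dies later was a free choice. *)
Lemma late_death_isolated j x : j < n -> j < death j -> x < j -> ~~ adjacent (pos x) (pos j).
Proof.
move=> jn dj xj; have xn := ltn_trans xj jn.
apply/negP => /(@adjacent_linked j.+1); rewrite !(posK tim) // ltnS (ltnW xj) ltnSn => /(_ isT isT) L.
have := before_find 0 dj; rewrite nth_iota // add0n.
by rewrite (leq_ltn_trans (birth_le xn L) xj).
Qed.

Lemma mismatch_le : mismatch <= n.
Proof. by rewrite -{1}(size_iota 0 n) find_size. Qed.

Lemma match_before k : k < mismatch -> odd (younger k) = odd k.
Proof.
move=> km; have kn := leq_trans km mismatch_le.
by have := before_find 0 km; rewrite nth_iota // add0n => /negbFE/eqP.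
Qed.

Lemma mismatch_at : mismatch < n -> odd (younger mismatch) = ~~ odd mismatch.
Proof.
move=> mn; have hm : has (fun k => odd (younger k) != odd k) (iota 0 n).
  by rewrite has_find size_iota.
by have := nth_find 0 hm; rewrite nth_iota // add0n -/mismatch; do 2 case: odd.
Qed.

Lemma younger_le k : younger k <= k.
Proof. by rewrite /younger /side; lia. Qed.

End Persistence.

(** * The elder strategy *)

Section Plays.

Variables (n : nat) (V : finType) (e : rel V) (f : 'I_n -> V).
Variables (pos tau : nat -> nat).
Hypothesis tim : timing n pos tau.
Hypothesis adjE : forall i j : 'I_n, e (f i) (f j) = adjacent (pos i) (pos j).

Lemma legalP h c :
  reflect (size h < n /\ forall j, j < size h -> adjacent (pos (size h)) (pos j) ->
             nth false h j != c)
          (legal e f h c).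
Proof.
apply: (iffP existsP) => [[i /andP[/eqP si /forallP H]]|[sn H]].
- rewrite -si; split => // j ji aj; have jn := ltn_trans ji (ltn_ord i).
  by have := H (Ordinal jn); rewrite adjE /= ji aj.
- exists (Ordinal sn); rewrite eqxx; apply/forallP => j; apply/implyP.
  by rewrite adjE => /andP[/= js]; apply: H.
Qed.

Lemma legal_play_size h : legal_play e f h -> size h <= n.
Proof.
case: (posnP (size h)) => [-> //|s0] /(_ (size h).-1).
rewrite prednK // => /(_ (leqnn _)) /legalP[].
by rewrite size_takel ?leq_pred // prednK.
Qed.

(** The color at [q] relative to one of the two proper colorings of the path:
    a coloring is proper if and only if this bit is locally constant. *)
Definition shade (h : seq bool) q : bool := nth false h (tau q) (+) odd q.

Lemma shade_next h q : legal_play e f h ->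
  tau q < size h -> tau q.+1 < size h -> shade h q = shade h q.+1.
Proof.
move=> play; have sn := legal_play_size play.
have later x y : adjacent x y -> tau x < tau y -> tau y < size h ->
    nth false h (tau x) != nth false h (tau y).
  move=> xy lt ty; have [_] := legalP _ _ (play _ ty).
  rewrite size_takel ?(ltnW ty) // => /(_ (tau x) lt).
  rewrite !(tauK tim) ?nth_take; try lia.
  by apply; rewrite /adjacent orbC.
move=> tq tq1; have ne : nth false h (tau q) != nth false h (tau q.+1).
  have [lt|gt|E] := ltngtP (tau q) (tau q.+1).
  - by apply: later; rewrite // /adjacent eqxx.
  - by rewrite eq_sym; apply: later; rewrite // /adjacent eqxx orbT.
  - have E1 := tauK tim (leq_trans tq sn).
    by have := tauK tim (leq_trans tq1 sn); rewrite -E E1 => /n_Sn.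
by move: ne; rewrite /shade /=; do 2 case: nth; case: odd.
Qed.

Lemma shade_linked h x y : legal_play e f h -> linked tau (size h) x y -> shade h x = shade h y.
Proof.
move=> play; wlog xy : x y / x <= y.
  by move=> W; case: (leqP x y) => [|/ltnW] /W // H; rewrite linked_sym => /H.
rewrite -(subnKC xy); elim: (y - x) => [|d IH] L; first by rewrite addn0.
have /linkedP T := L; rewrite IH.
  by rewrite addnS; apply: shade_next => //; apply: T; lia.
by apply/linkedP => q ?; apply: T; lia.
Qed.

(** A blocked turn needs neighbors of both colors; as a vertex has at most two
    neighbors, both are colored, with different shades. *)
Lemma stuck_shades h : size h < n -> stuck e f h ->
  let q := pos (size h) in
  [/\ tau q.-1 < size h, tau q.+1 < size h & shade h q.-1 != shade h q.+1].
Proof.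
set m := size h => mn st q.
have block c : exists j, [/\ j < m, (pos j == q.-1) || (pos j == q.+1) & nth false h j = c].
  have /hasP[j] : has (fun j => adjacent q (pos j) && (nth false h j == c)) (iota 0 m).
    apply: contraNT (st c) => /hasPn H; apply/legalP; split=> // j jm aj.
    by have := H j; rewrite mem_iota aj /=; apply.
  rewrite mem_iota => /andP[_ jm] /andP[aj /eqP cj]; exists j; split=> //.
  by move: aj; rewrite /adjacent; lia.
(* Both neighbors have positions of the same parity, so different colors give
   different shades. *)
have q0 : odd q.-1 = odd q.+1 by have : 0 < q := pos_gt0 tim mn; case: (q) => //= q1; rewrite negbK.
have [i [im pi ci]] := block true; have [j [jm pj cj]] := block false.
have ti := posK tim (ltn_trans im mn); have tj := posK tim (ltn_trans jm mn).
have ne : pos i != pos j by apply: contra_eq_neq ci => E; rewrite -ti E tj cj.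
rewrite /shade q0; case/orP: pi => /eqP Ei; case/orP: pj => /eqP Ej.
- by rewrite Ei Ej eqxx in ne.
- by rewrite -Ei -Ej ti tj ci cj im jm; case: odd.
- by rewrite -Ei -Ej ti tj ci cj im jm; case: odd.
- by rewrite Ei Ej eqxx in ne.
Qed.

Lemma legal_play_rcons h c : legal_play e f h -> legal e f h c -> legal_play e f (rcons h c).
Proof.
move=> play lc k; rewrite size_rcons ltnS leq_eqVlt => /orP[/eqP ->|kh].
  by rewrite -cats1 take_size_cat // nth_cat ltnn subnn.
by rewrite -cats1 take_cat nth_cat kh; apply: play.
Qed.

(** A single function may speak for both players; the play it produces cannot
    go on forever. *)
Lemma play_exists (s : seq bool -> bool) :
  (forall h, legal_play e f h -> ~ stuck e f h -> legal e f h (s h)) ->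
  exists h, [/\ legal_play e f h, stuck e f h &
    forall k, k < size h -> nth false h k = s (take k h)].
Proof.
move=> sL.
have ext d : forall h, n - size h <= d -> legal_play e f h ->
    (forall k, k < size h -> nth false h k = s (take k h)) ->
    exists h, [/\ legal_play e f h, stuck e f h &
      forall k, k < size h -> nth false h k = s (take k h)].
  elim: d => [|d IH] h hd play fol.
    by exists h; split=> // c; apply/negP => /legalP[]; lia.
  case E: (legal e f h true || legal e f h false); last first.
    by exists h; split=> //; move/norP: (negbT E) => [? ?] [].
  have lc : legal e f h (s h).
    by apply: sL => // st; case/orP: E; apply/negP; apply: st.
  apply: (IH (rcons h (s h))).
  - by have [] := legalP _ _ lc; rewrite size_rcons; lia.
  - exact: legal_play_rcons.
  - move=> k; rewrite size_rcons ltnS leq_eqVlt => /orP[/eqP ->|kh].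
      by rewrite -cats1 take_size_cat // nth_cat ltnn subnn.
    by rewrite -cats1 take_cat nth_cat kh; apply: fol.
by apply: (ext n [::]); rewrite ?leq_subr // => k.
Qed.

Let T := mismatch n pos tau.

(** The elder strategy wants the shade of the interval into which the current
    vertex is to be absorbed, or the opposite one if that happens at the turn
    to be spoiled. *)
Definition aim (h : seq bool) : bool :=
  let j := size h in let k := death n pos tau j in
  shade h (pos (birth n pos tau k.+1 (pos j))) (+) (k == T) (+) odd (pos j).

Definition elder_strategy (h : seq bool) : bool :=
  if legal e f h (aim h) then aim h else ~~ aim h.

Lemma elder_strategy_legal h : ~ stuck e f h -> legal e f h (elder_strategy h).
Proof.
move=> nst; rewrite /elder_strategy; case: ifP => // /negbT la.
apply: contraPT nst => lna st; apply: st => c.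
by case: (boolP (c == aim h)) => [/eqP ->|/negPf] //; case: c lna => //=; case: aim.
Qed.

(** The turn [younger k] is a free choice, so the strategy gets its wish. *)
Lemma elder_strategy_aims h k :
  let u := elder n pos tau k in let j := younger n pos tau k in
  k < n -> j < k -> j < size h -> nth false h j = elder_strategy (take j h) ->
  shade h (pos j) = shade h (pos u) (+) (k == T).
Proof.
move=> u j kn jk jh fol; have jn := ltn_trans jk kn.
have [uj dj rj _] := younger_dies tim kn jk.
have sj : size (take j h) = j by rewrite size_takel // ltnW.
have free c : legal e f (take j h) c.
  apply/legalP; rewrite sj; split=> // x xj ax.
  have := late_death_isolated tim jn _ xj; rewrite dj => /(_ jk) /negP[].
  by rewrite /adjacent orbC.
move: fol; rewrite /elder_strategy free /aim sj dj rj /shade.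
rewrite !(posK tim) //; last exact: ltn_trans uj jn.
by rewrite nth_take // => ->; do 2 case: odd; case: nth; case: eqP.
Qed.

(** A loss of the strategy would be a stuck turn [m] of the other parity than
    [T].  Before [T], the two intervals meeting at [m] have different shades,
    although the younger one was started by the strategy, with the shade of the
    elder.  After [T], the intervals merged at turn [T] have the same shade,
    although the younger one was started by the strategy against the elder. *)
Lemma elder_strategy_wins h :
  legal_play e f h -> stuck e f h ->
  (forall k, k < size h -> odd k = ~~ odd T -> nth false h k = elder_strategy (take k h)) ->
  odd (size h) = odd T.
Proof.
move=> play st fol; apply/eqP/negPn/negP => odd_ne.
have {}odd_ne : odd (size h) = ~~ odd T by move: odd_ne; do 2 case: odd.
set m := size h in odd_ne *; have mn : m <= n := legal_play_size play.
have [mT|Tm|mT] := ltngtP m T; last by rewrite mT in odd_ne; case: odd odd_ne.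
- have {}mn : m < n := leq_trans mT (mismatch_le _ _ _).
  have /= := stuck_shades mn st; rewrite -/m => -[tl tr ne].
  have ym : younger n pos tau m < m by rewrite gtn_max !(side_lt tim) ?(ltnW mn) // tl tr.
  have := match_before mT; rewrite -/m => om.
  have [uj dj rj L] := younger_dies tim mn ym.
  have := elder_strategy_aims mn ym ym (fol _ ym _); rewrite om odd_ne => /(_ erefl).
  rewrite (ltn_eqF mT) addbF => E; move: ne.
  by case: L => [] [/(shade_linked play) <- /(shade_linked play) <-]; rewrite E eqxx.
- have Tn : T < n := leq_trans Tm mn.
  have oT := mismatch_at Tn; rewrite -/T in oT.
  have yT : younger n pos tau T < T.
    rewrite ltn_neqAle younger_le andbT; apply: contra_eq_neq oT => ->.
    by case: odd.
  have ym := ltn_trans yT Tm.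
  have [uj dj rj L] := younger_dies tim Tn yT.
  have := elder_strategy_aims Tn yT ym (fol _ ym oT).
  rewrite eqxx (shade_linked play (_ : linked tau m _ (pos (elder n pos tau T)))).
    by case: shade.
  rewrite linked_sym -rj; apply: linked_mono Tm (birth_link tim _ _) => //.
  by rewrite (posK tim) ?(ltn_trans yT) // ltnW.
Qed.

(** If [T] is odd, the strategy is used for the first player against a
    supposed winning strategy of the second. *)
Lemma P_positionE : P_position e f <-> ~~ odd T.
Proof.
split=> [[s [sL sW]]|T_even].
- apply/negP => T_odd.
  (* The second player follows [s], the first one the elder strategy. *)
  pose both h := if odd (size h) then s h else elder_strategy h.
  have [|h [play st fol]] := @play_exists both.
    move=> h play nst; rewrite /both; case: ifP => ho; first exact: sL.
    exact: elder_strategy_legal.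
  have : ~~ odd (size h).
    apply: (sW) => // k kh ko; rewrite fol // /both size_takel ?(ltnW kh) //.
    by rewrite ko.
  rewrite (elder_strategy_wins play st) ?T_odd // => k kh /negbT ko.
  by rewrite fol // /both size_takel ?(ltnW kh) // (negPf ko).
- exists elder_strategy; split=> [h _ _|h play fol st]; first exact: elder_strategy_legal.
  rewrite (elder_strategy_wins play st) // => k kh; rewrite T_even; exact: fol.
Qed.

End Plays.

(** * Maintaining the intervals at their ends *)

Section Intervals.

Variables (n : nat) (pos tau label : nat -> nat).
Hypothesis tim : timing n pos tau.
Hypothesis label_inj : forall a b, tau a < n -> label a = label b -> a = b.
Hypothesis label_gt0 : forall q, tau q < n -> 0 < label q.

(** The far end of the interval reached from a vertex [v] through its neighbor
    [x], and its birth, counting [v] itself as an interval born at turn [i] when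
    [x] is uncolored.  The product with a truth value replaces a case
    distinction, which keeps the program straight-line; it relies on uncolored
    vertices having zero entries. *)
Definition far (oth : nat -> nat) v x := oth x + v * (oth x == 0).
Definition age (oth bir : nat -> nat) i x := bir x + i * (oth x == 0).

(** Entries at inner vertices of an interval are left over from earlier turns
    and unconstrained.  An uncolored vertex only ever touches the ends of
    intervals, so these entries are never read. *)
Record intervals (i : nat) (oth bir : nat -> nat) : Prop := Intervals {
  blank : forall q, i <= tau q -> oth (label q) = 0 /\ bir (label q) = 0;
  ends : forall a b, a <= b -> linked tau i a b -> i <= tau a.-1 -> i <= tau b.+1 ->
    [/\ oth (label a) = label b, oth (label b) = label a,
        bir (label a) = birth n pos tau i a & bir (label b) = birth n pos tau i b] }.

Lemma stretch_left k q : k <= n -> tau q < k ->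
  exists a, [/\ a <= q, linked tau k a q & k <= tau a.-1].
Proof.
move=> kn; elim: q => [|q IH] tq; first by have := tau_left tim; lia.
case: (ltnP (tau q) k) => t; last by exists q.+1; rewrite linkedxx.
have [a [aq la ta]] := IH t; exists a; split=> //; first exact: leqW.
by apply: linked_trans la (linked_next _ t tq).
Qed.

Lemma stretch_right k q : k <= n -> tau q < k ->
  exists b, [/\ q <= b, linked tau k q b & k <= tau b.+1].
Proof.
move=> kn; move: {2}(n - q) (leqnn (n - q)) => d; elim: d q => [|d IH] q qd tq.
  exists q; split; rewrite ?linkedxx //.
  by apply: leq_trans kn (tau_right tim _); lia.
case: (ltnP (tau q.+1) k) => t; last by exists q; rewrite linkedxx.
have qn : q <= n by rewrite leqNgt; apply/negP => /(tau_right tim); lia.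
have [|b [bq lb tb]] := IH q.+1 _ t; first by lia.
exists b; split=> //; first exact: ltnW.
by apply: linked_trans (linked_next _ tq t) lb.
Qed.

Lemma scan_left i oth bir : i < n -> intervals i oth bir ->
  let q := pos i in
  exists a, [/\ a <= q, linked tau i.+1 a q, i < tau a.-1,
    far oth (label q) (label q.-1) = label a &
    age oth bir i (label q.-1) = side n pos tau i q.-1].
Proof.
move=> i_n inv q; have q0 : 0 < q := pos_gt0 tim i_n.
have tq : tau q = i := posK tim i_n.
have others x : x < q -> i <= tau x -> i < tau x.
  move=> xq; rewrite leq_eqVlt => /orP[/eqP|//] E.
  by move: (xq); rewrite (tau_pos_eq tim i_n (esym E)) ltnn.
case: (ltnP (tau q.-1) i) => t.
- have [a [aq la ta]] := stretch_left (ltnW i_n) t.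
  have [|oa ob ba bb] := ends inv aq la ta; first by rewrite prednK // tq.
  have : 0 < label a by apply: label_gt0; have := linkedl la; lia.
  exists a; split.
  + exact: leq_trans aq (leq_pred _).
  + apply: linked_trans (linked_mono (leqnSn i) la) _.
    exact: (linked_pred_new tim i_n t).
  + by apply: others => //; lia.
  + by rewrite /far ob; lia.
  + by rewrite /age ob bb (side_birth tim) //; lia.
- have [oq bq] := blank inv t.
  exists q; split; rewrite ?linkedxx ?tq //.
  + by apply: others => //; lia.
  + by rewrite /far oq; lia.
  + by rewrite /age oq bq side_blank //; lia.
Qed.

Lemma scan_right i oth bir : i < n -> intervals i oth bir ->
  let q := pos i in
  exists b, [/\ q <= b, linked tau i.+1 q b, i < tau b.+1,
    far oth (label q) (label q.+1) = label b &
    age oth bir i (label q.+1) = side n pos tau i q.+1].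
Proof.
move=> i_n inv q.
have tq : tau q = i := posK tim i_n.
have others x : q < x -> i <= tau x -> i < tau x.
  move=> xq; rewrite leq_eqVlt => /orP[/eqP|//] E.
  by move: (xq); rewrite (tau_pos_eq tim i_n (esym E)) ltnn.
case: (ltnP (tau q.+1) i) => t.
- have [b [bq lb tb]] := stretch_right (ltnW i_n) t.
  have [|oa ob ba bb] := ends inv bq lb _ tb; first by rewrite /= tq.
  have : 0 < label b by apply: label_gt0; have := linkedr lb; lia.
  exists b; split.
  + exact: ltnW.
  + apply: linked_trans (linked_mono (leqnSn i) lb).
    by rewrite linked_sym; apply: (linked_succ_new tim).
  + by apply: others => //; lia.
  + by rewrite /far oa; lia.
  + by rewrite /age oa ba (side_birth tim) //; lia.
- have [oq bq] := blank inv t.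
  exists q; split; rewrite ?linkedxx ?tq //.
  + by apply: others => //; lia.
  + by rewrite /far oq; lia.
  + by rewrite /age oq bq side_blank //; lia.
Qed.

(** Only the two far ends of the new interval need new entries.  The values are
    specified at these ends and elsewhere, without an order of assignment,
    because the ends coincide when the new interval is a single vertex and are
    exchanged when the two neighbors come in the other order. *)
Lemma intervals_step i oth bir oth' bir' : i < n -> intervals i oth bir ->
  let q := pos i in
  let L := far oth (label q) (label q.-1) in
  let R := far oth (label q) (label q.+1) in
  [/\ oth' L = R, oth' R = L, bir' L = elder n pos tau i & bir' R = elder n pos tau i] ->
  (forall x, x != L -> x != R -> oth' x = oth x /\ bir' x = bir x) ->
  intervals i.+1 oth' bir'.
Proof.
move=> i_n inv q L R.
have [a [aq la ta EL _]] := scan_left i_n inv.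
have [b [bq lb tb ER _]] := scan_right i_n inv.
rewrite {}/L {}/R EL ER => -[oL oR bL bR] old.
have labN x c : tau c < n -> x != c -> label x != label c.
  by move=> tc; apply: contraNneq => /esym /(label_inj tc) ->.
have tan : tau a < n by have := linkedl la; lia.
have tbn : tau b < n by have := linkedr lb; lia.
split=> [x tx|a' b' ab' l' ta' tb'].
  have [||-> ->] := old (label x).
  - apply: labN => //; apply: contraTneq tx => ->; rewrite -ltnNge; exact: linkedl la.
  - apply: labN => //; apply: contraTneq tx => ->; rewrite -ltnNge; exact: linkedr lb.
  - by apply: (blank inv); exact: ltnW.
case: (boolP (linked tau i.+1 a' q)) => l.
  have /linkedP Ha := la; have /linkedP Hb := lb; have /linkedP H' := l'; have /linkedP Hl := l.
  have a'q : a' <= q.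
    by rewrite leqNgt; apply/negP => ?; have := Hl a'.-1; lia.
  have qb' : q <= b'.
    by rewrite leqNgt; apply/negP => ?; have := Hl b'.+1; lia.
  have -> : a' = a.
    by have := Ha a'.-1; have := H' a.-1; lia.
  have -> : b' = b.
    by have := Hb b'.+1; have := H' b.+1; lia.
  split=> //; rewrite ?bL ?bR (birth_new tim) //.
  by rewrite linked_sym.
have tan' : tau a' < i.+1 := linkedl l'.
have tbn' : tau b' < i.+1 := linkedr l'.
have lba : ~~ linked tau i.+1 b' q.
  by apply: contraNN l => l; apply: linked_trans l' l.
have Na : a' != a by apply: contraNneq l => ->.
have Nb : b' != b by apply: contraNneq lba => ->; rewrite linked_sym.
have Nab : a' != b by apply: contraNneq l => ->; rewrite linked_sym.
have Nba : b' != a by apply: contraNneq lba => ->.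
have [oa ba] := old _ (labN _ _ tan Na) (labN _ _ tbn Nab).
have [ob bb] := old _ (labN _ _ tan Nba) (labN _ _ tbn Nb).
rewrite oa ob ba bb !(birth_old tim) //.
apply: (ends inv) => //; try exact: ltnW.
by case/(linked_succ tim i_n): l' => // -[/idPn]; rewrite l.
Qed.

Lemma intervals_start oth bir : (forall x, oth x = 0 /\ bir x = 0) -> intervals 0 oth bir.
Proof. by move=> H; split=> [q _|a b _ /linkedl //]; exact: H. Qed.

End Intervals.

(** * Reasoning about programs *)

(** The value of an expression when no bound is exceeded; [safe] collects the
    bounds to be checked. *)
Fixpoint den (s : state) (t : expr) : nat :=
  match t with
  | Const k => k
  | Var x => var s x
  | Get a t1 => arr s a (den s t1)
  | Op o t1 t2 => eval_op o (den s t1) (den s t2)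
  end.

Fixpoint safe (W : nat) (s : state) (t : expr) : Prop :=
  match t with
  | Const k => k <= W
  | Var x => var s x <= W
  | Get a t1 => safe W s t1 /\ arr s a (den s t1) <= W
  | Op o t1 t2 => [/\ safe W s t1, safe W s t2 & eval_op o (den s t1) (den s t2) <= W]
  end.

Lemma eval_den W s t : safe W s t -> eval W s t = Some (den s t).
Proof.
elim: t => [k|x|a t IH|o t1 IH1 t2 IH2] /=; rewrite /guard.
- by move=> ->.
- by move=> ->.
- by case=> /IH -> /= ->.
- by case=> /IH1 -> /IH2 -> /= ->.
Qed.

(** Weakest preconditions for loop-free programs.  Loops get no precondition;
    they are treated by [halts_while]. *)
Fixpoint wp (W : nat) (c : cmd) (s : state) (Q : state -> Prop) : Prop :=
  match c with
  | Skip => Q s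
  | Assign x t => safe W s t /\ Q (set_var s x (den s t))
  | Put a i t => [/\ safe W s i, safe W s t & Q (set_arr s a (den s i) (den s t))]
  | Seq c1 c2 => wp W c1 s (fun s1 => wp W c2 s1 Q)
  | If b c1 c2 => safe W s b /\ if den s b != 0 then wp W c1 s Q else wp W c2 s Q
  | While _ _ => False
  end.

(** For a loop-free program the cost of the dearer branch bounds the running
    time in every state. *)
Fixpoint time (c : cmd) : nat :=
  match c with
  | Skip => 1
  | Assign _ t => (cost t).+1
  | Put _ i t => (cost i + cost t).+1
  | Seq c1 c2 => time c1 + time c2
  | If b c1 c2 => (cost b + maxn (time c1) (time c2)).+1
  | While _ _ => 0
  end.

Definition halts (W : nat) (c : cmd) (s : state) (B : nat) (Q : state -> Prop) : Prop :=
  exists s' t, [/\ exec W c s s' t, t <= B & Q s'].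

Lemma halts_wp W c s Q : wp W c s Q -> halts W c s (time c) Q.
Proof.
elim: c s Q => [|x t|a i t|c1 IH1 c2 IH2|b c1 IH1 c2 IH2|b c _] s Q //=.
- by exists s, 1; split=> //; apply: ExecSkip.
- move=> [/eval_den E q]; exists (set_var s x (den s t)), (cost t).+1.
  by split=> //; apply: ExecAssign.
- move=> [/eval_den Ei /eval_den Et q].
  by exists (set_arr s a (den s i) (den s t)), (cost i + cost t).+1; split=> //; apply: ExecPut.
- move=> /IH1 [s1 [t1 [e1 b1 /IH2 [s2 [t2 [e2 b2 q]]]]]].
  by exists s2, (t1 + t2); split=> //; [apply: ExecSeq e1 e2 | apply: leq_add].
- case=> /eval_den E; case: eqP => [z|/eqP nz] /=.
  + move=> /IH2 [s' [t [ex tB q]]]; exists s', (cost b + t).+1; split=> //; last by lia.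
    by apply: ExecIfFalse ex; rewrite E z.
  + move=> /IH1 [s' [t [ex tB q]]]; exists s', (cost b + t).+1; split=> //; last by lia.
    exact: ExecIfTrue E nz ex.
Qed.

Lemma halts_seq W c1 c2 s B1 B2 Q R :
  halts W c1 s B1 Q -> (forall s1, Q s1 -> halts W c2 s1 B2 R) ->
  halts W (Seq c1 c2) s (B1 + B2) R.
Proof.
move=> [s1 [t1 [e1 b1 q]]] /(_ _ q) [s2 [t2 [e2 b2 r]]].
by exists s2, (t1 + t2); split=> //; [apply: ExecSeq e1 e2 | apply: leq_add].
Qed.

(** The index of the invariant decreases at each iteration, hence bounds the
    number of iterations; the additional one pays for the last test. *)
Lemma halts_while W b c (I : nat -> state -> Prop) Q :
  (forall m s, I m s -> safe W s b) ->
  (forall m s, I m s -> den s b = 0 -> Q s) ->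
  (forall m s, I m s -> den s b != 0 -> exists2 m', m' < m & wp W c s (I m')) ->
  forall m s, I m s -> halts W (While b c) s ((cost b + time c).+1 * m.+1) Q.
Proof.
move=> ok out body; elim/ltn_ind => m IH s inv.
have E := eval_den (ok _ _ inv).
case: (eqVneq (den s b) 0) => [z|nz].
  exists s, (cost b).+1; split; last exact: out inv z.
    by apply: ExecWhileFalse; rewrite E z.
  by lia.
have [m' mm /halts_wp [s1 [t1 [e1 b1 /(IH _ mm) [s2 [t2 [e2 b2 q]]]]]]] := body _ _ inv nz.
exists s2, (cost b + t1 + t2).+1; split=> //; first exact: ExecWhileTrue E nz e1 e2.
have : (cost b + time c).+1 * m'.+1 <= (cost b + time c).+1 * m by rewrite leq_mul2l mm orbT.
by lia.
Qed.

Lemma wp_mono W c s Q R : (forall s', Q s' -> R s') -> wp W c s Q -> wp W c s R.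
Proof.
elim: c s Q R => [|x t|a i t|c1 IH1 c2 IH2|b c1 IH1 c2 IH2|b c _] s Q R QR //=.
- exact: QR.
- by case=> ? /QR.
- by case=> ? ? /QR.
- by apply: IH1 => s'; apply: IH2.
- by case=> ?; case: ifP => _ H; split=> //; [apply: IH1 H | apply: IH2 H].
Qed.

(** * The program *)

(** The arrays [a_turn], [a_src] and [a_dst] are the input; [a_oth] and [a_bir]
    hold the opposite ends and the births of intervals, indexed by vertices
    increased by one, the two neighbor arrays are indexed by vertices. *)
Local Notation x_n := 0.
Local Notation x_i := 1.
Local Notation x_v := 2.
Local Notation x_l := 3.
Local Notation x_r := 4.
Local Notation x_L := 5.
Local Notation x_R := 6.
Local Notation x_bl := 7.
Local Notation x_br := 8.
Local Notation a_turn := 0.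
Local Notation a_src := 1.
Local Notation a_dst := 2.
Local Notation a_nb1 := 3.
Local Notation a_nb2 := 4.
Local Notation a_oth := 5.
Local Notation a_bir := 6.

Local Infix ";;" := Seq (at level 60, right associativity).

(** The two neighbor arrays hold the first two items of a list of neighbors, so
    pushing a new item shifts the first item to the second place.  Vertices are
    stored increased by one, and zero means that there is no neighbor. *)
Definition shift_neighbor (x : nat) : cmd :=
  Put a_nb2 (Var x) (Get a_nb1 (Var x)).
Definition store_neighbor (x y : nat) : cmd :=
  Put a_nb1 (Var x) (Op OpAdd (Var y) (Const 1)).

Definition increment (x : nat) : cmd := Assign x (Op OpAdd (Var x) (Const 1)).

Definition read_edge : cmd :=
  Assign x_l (Get a_src (Var x_i)) ;;
  Assign x_r (Get a_dst (Var x_i)) ;;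
  shift_neighbor x_l ;;
  store_neighbor x_l x_r ;;
  shift_neighbor x_r ;;
  store_neighbor x_r x_l ;;
  increment x_i.

(** A path on [n] vertices has [n - 1] edges. *)
Definition edge_loop : cmd :=
  While (Op OpLt (Op OpAdd (Var x_i) (Const 1)) (Var x_n)) read_edge.

Definition unless_colored (x : nat) (t : expr) : expr :=
  Op OpMul t (Op OpEq (Get a_oth (Var x)) (Const 0)).

Definition scan_far (x y : nat) : cmd :=
  Assign y (Op OpAdd (Get a_oth (Var x)) (unless_colored x (Var x_v))).
Definition scan_age (x y : nat) : cmd :=
  Assign y (Op OpAdd (Get a_bir (Var x)) (unless_colored x (Var x_i))).

(** Truncated subtraction yields the minimum and the maximum without a test. *)
Definition min_expr (x y : nat) : expr :=
  Op OpSub (Var x) (Op OpSub (Var x) (Var y)).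
Definition max_expr (x y : nat) : expr :=
  Op OpAdd (Var x) (Op OpSub (Var y) (Var x)).
Definition parity (t : expr) : expr := Op OpMod t (Const 2).

Definition play_turn : cmd :=
  Assign x_v (Get a_turn (Var x_i)) ;;
  Assign x_l (Get a_nb1 (Var x_v)) ;;
  Assign x_r (Get a_nb2 (Var x_v)) ;;
  increment x_v ;;
  scan_far x_l x_L ;;
  scan_far x_r x_R ;;
  scan_age x_l x_bl ;;
  scan_age x_r x_br ;;
  Put a_oth (Var x_L) (Var x_R) ;;
  Put a_oth (Var x_R) (Var x_L) ;;
  Put a_bir (Var x_L) (min_expr x_bl x_br) ;;
  Put a_bir (Var x_R) (min_expr x_bl x_br) ;;
  If (Op OpEq (parity (max_expr x_bl x_br)) (parity (Var x_i)))
    (increment x_i)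
    (Assign x_n (Var x_i)).

(** At a mismatch the variable of [n] is lowered to the current turn: this ends
    the loop and records the mismatch, while [n] itself remains there when no
    mismatch is found. *)
Definition turn_loop : cmd := While (Op OpLt (Var x_i) (Var x_n)) play_turn.

Definition answer : cmd := Assign x_n (parity (Op OpAdd (Var x_n) (Const 1))).

Definition decide : cmd :=
  edge_loop ;; Assign x_i (Const 0) ;; turn_loop ;; answer.

Definition push (x y z : nat) (r : seq nat) : seq nat := if z == x then y.+1 :: r else r.

(** The list whose first two items the neighbor arrays hold for vertex [z] once
    the edges [F] have been read. *)
Definition neighbors (F : seq (nat * nat)) (z : nat) : seq nat :=
  foldl (fun r uv => push uv.2 uv.1 z (push uv.1 uv.2 z r)) [::] F.

Lemma neighbors_rcons F uv z :
  neighbors (rcons F uv) z = push uv.2 uv.1 z (push uv.1 uv.2 z (neighbors F z)).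
Proof. by rewrite /neighbors foldl_rcons. Qed.

Lemma count_neighbors F z c :
  count_mem c.+1 (neighbors F z) = count_mem (z, c) F + count_mem (c, z) F.
Proof.
elim/last_ind: F => [//|F [u v] IH].
rewrite neighbors_rcons /push /= -!cats1 !count_cat /= !xpair_eqE.
rewrite (eq_sym z u) (eq_sym z v).
by case: (u == z); case: (v == z); rewrite /= ?eqSS IH ?andbT ?andbF /=; lia.
Qed.

Lemma zero_neighbors F z : 0 \notin neighbors F z.
Proof.
elim/last_ind: F => [//|F [u v] IH].
by rewrite neighbors_rcons /push; do 2 case: eqP.
Qed.

Lemma neighbors_le n F z j : (forall x, x \in F -> x.1 < n /\ x.2 < n) ->
  nth 0 (neighbors F z) j <= n.
Proof.
move=> bF; have : all (fun y => y <= n) (neighbors F z).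
  elim/last_ind: F bF => [//|F [u v] IH] bF.
  have uvF : (u, v) \in rcons F (u, v) by rewrite mem_rcons mem_head.
  have [/= un vn] := bF _ uvF.
  have {}IH : all (fun y => y <= n) (neighbors F z).
    by apply: IH => x xF; apply: bF; rewrite mem_rcons inE xF orbT.
  by rewrite neighbors_rcons /push; do 2 case: eqP => _ //=; rewrite ?un ?vn.
by move/(all_nthP 0) => H; case: (ltnP j (size (neighbors F z))) => [/H //|/(nth_default 0) ->].
Qed.

(** Invariant of the first loop, after [k] edges. *)
Record reading (n : nat) (F : seq (nat * nat)) (s0 s : state) (k : nat) : Prop := Reading {
  rd_n : var s x_n = n;
  rd_i : var s x_i = k;
  rd_in : forall a, a < 3 -> arr s a = arr s0 a;
  rd_nb1 : forall z, arr s a_nb1 z = nth 0 (neighbors (take k F) z) 0;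
  rd_nb2 : forall z, arr s a_nb2 z = nth 0 (neighbors (take k F) z) 1;
  rd_oth : forall z, arr s a_oth z = 0;
  rd_bir : forall z, arr s a_bir z = 0 }.

Lemma nth_pushed x y z r : nth 0 (push x y z r) 1 = if z == x then nth 0 r 0 else nth 0 r 1.
Proof. by rewrite /push; case: eqP. Qed.

(** Stepping through one assignment at a time, with its value named in advance,
    keeps the description of the state small: unfolding a whole precondition
    would copy each value into every later use. *)
Lemma wp_assign W x t c s Q v :
  safe W s t /\ den s t = v -> wp W c (set_var s x v) Q -> wp W (Assign x t ;; c) s Q.
Proof. by case=> st <- H; split. Qed.

Lemma wp_put W a ti t c s Q i v :
  safe W s ti /\ den s ti = i -> safe W s t /\ den s t = v ->
  wp W c (set_arr s a i v) Q -> wp W (Put a ti t ;; c) s Q.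
Proof. by case=> sti <- [st <-] H; split. Qed.

Arguments wp : simpl never.

Lemma read_edge_step n W F s0 s k : 
  n.+1 <= W -> size F = n.-1 -> (forall x, x \in F -> x.1 < n /\ x.2 < n) ->
  (forall z, arr s0 a_src z = nth 0 [seq x.1 | x <- F] z) ->
  (forall z, arr s0 a_dst z = nth 0 [seq x.2 | x <- F] z) ->
  k.+1 < n -> reading n F s0 s k ->
  wp W read_edge s (fun s' => reading n F s0 s' k.+1).
Proof.
move=> nW sF bF src dst kn [rn ri rin r1 r2 ro rb].
have kF : k < size F by lia.
have [uk vk] := bF _ (mem_nth (0,0) kF).
have nbW z j : nth 0 (neighbors (take k F) z) j <= n.
  by apply: neighbors_le => x /mem_take; apply: bF.
move: uk vk; case uvE: (nth _ F k) => [u v] /= uk vk.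
have iu : arr s a_src k = u by rewrite rin // src (nth_map (0, 0)) // uvE.
have iv : arr s a_dst k = v by rewrite rin // dst (nth_map (0, 0)) // uvE.
have nextE z : neighbors (take k.+1 F) z = push v u z (push u v z (neighbors (take k F) z)).
  by rewrite (take_nth (0, 0)) // uvE neighbors_rcons.
have nb1_le z : arr s a_nb1 z <= n by rewrite r1.
have v_le : (if v == u then v.+1 else arr s a_nb1 v) <= n by case: eqP.
apply: (wp_assign (v := u)); first by rewrite /= ri iu; lia.
apply: (wp_assign (v := v)); first by rewrite /= /upd /= ri iv; lia.
apply: (wp_put (i := u) (v := arr s a_nb1 u)); [by rewrite /= /upd /=; have := nb1_le u; lia..|].
apply: (wp_put (i := u) (v := v.+1)); [by rewrite /= /upd /= ?addn1; repeat split; lia..|].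
apply: (wp_put (i := v) (v := if v == u then v.+1 else arr s a_nb1 v)); [by rewrite /= /upd /=; lia..|].
apply: (wp_put (i := v) (v := u.+1)); [by rewrite /= /upd /= ?addn1; repeat split; lia..|].
split; first by rewrite /= /upd /= ri; split; lia.
split=> /=; rewrite /upd /= ?addn1 ?ri //.
- by case=> [|[|[|a]]] //= _; apply: rin.
- move=> z; rewrite nextE /push !r1; case: (eqVneq z v) => [->|zv]; first by case: eqP.
  by case: eqP.
- move=> z; rewrite nextE !nth_pushed /push !r1 !r2.
  case: (eqVneq z v) => [->|zv]; first by case: eqP.
  by case: (eqVneq z u) => [->|].
Qed.

(** Invariant of the second loop, before turn [i]. *)
Record scanning (n : nat) (pos tau label : nat -> nat) (s0 s : state) (i : nat) : Prop := Scanning {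
  sc_n : var s x_n = n;
  sc_i : var s x_i = i;
  sc_in : forall a, a < 5 -> arr s a = arr s0 a;
  sc_inv : intervals n pos tau label i (arr s a_oth) (arr s a_bir) }.

Section Scan.
Variables (n : nat) (pos tau label : nat -> nat).
Hypothesis tim : timing n pos tau.
Hypothesis label_inj : forall a b, tau a < n -> label a = label b -> a = b.
Hypothesis label_gt0 : forall q, tau q < n -> 0 < label q.
Hypothesis label_le : forall q, label q <= n.

(** The neighbors [l] and [r] come in unknown order.  Minimum and maximum are
    symmetric, and so is the update of the intervals, which makes the order
    immaterial. *)
Lemma scan_both i oth bir l r : i < n -> intervals n pos tau label i oth bir ->
  (l = label (pos i).-1 /\ r = label (pos i).+1) \/
  (l = label (pos i).+1 /\ r = label (pos i).-1) ->
  let v := label (pos i) in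
  let L := far oth v l in let R := far oth v r in
  [/\ L <= n /\ R <= n, age oth bir i l <= i /\ age oth bir i r <= i,
      maxn (age oth bir i l) (age oth bir i r) = younger n pos tau i,
      l <= n /\ r <= n &
      let m := minn (age oth bir i l) (age oth bir i r) in
      intervals n pos tau label i.+1 (upd (upd oth L R) R L) (upd (upd bir L m) R m)].
Proof.
move=> i_n inv.
have [a [_ _ _ La Aa]] := scan_left tim label_gt0 i_n inv.
have [b [_ _ _ Lb Ab]] := scan_right tim label_gt0 i_n inv.
have step := intervals_step tim label_inj label_gt0 i_n inv.
have sle q : side n pos tau i q <= i by rewrite geq_minl.
case=> -[-> ->] v L R; rewrite /L /R !Aa !Ab !La !Lb; split=> //.
- apply: step; rewrite La Lb /upd.
    by rewrite !eqxx; case: eqP => [->|].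
  by move=> x /negPf -> /negPf ->.
- by rewrite maxnC.
- rewrite minnC; apply: step; rewrite La Lb /upd.
    by rewrite !eqxx; case: eqP => [->|].
  by move=> x /negPf -> /negPf ->.
Qed.

Lemma play_turn_step W s0 s i :
  n.+1 <= W -> i < n ->
  (arr s0 a_turn i).+1 = label (pos i) ->
  (let x := arr s0 a_turn i in
   (arr s0 a_nb1 x = label (pos i).-1 /\ arr s0 a_nb2 x = label (pos i).+1) \/
   (arr s0 a_nb1 x = label (pos i).+1 /\ arr s0 a_nb2 x = label (pos i).-1)) ->
  scanning n pos tau label s0 s i ->
  wp W play_turn s (fun s' =>
    if odd (younger n pos tau i) == odd i then scanning n pos tau label s0 s' i.+1
    else var s' x_n = i /\ var s' x_i = i).
Proof.
move=> nW i_n lab nbs [sn si sin inv].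
have s0E : arr s0 a_turn = arr s a_turn /\ arr s0 a_nb1 = arr s a_nb1 /\ arr s0 a_nb2 = arr s a_nb2.
  by rewrite !sin.
case: s0E lab nbs => -> [-> ->] /=.
set v := arr s a_turn i; have vE : arr s a_turn i = v by [].
set l := arr s a_nb1 v; have lE : arr s a_nb1 v = l by [].
set r := arr s a_nb2 v; have rE : arr s a_nb2 v = r by [].
clearbody r l v => lab nbs.
have [] := scan_both i_n inv nbs; rewrite -lab.
have farE x : far (arr s a_oth) v.+1 x = arr s a_oth x + v.+1 * (arr s a_oth x == 0) by [].
have ageE x : age (arr s a_oth) (arr s a_bir) i x = arr s a_bir x + i * (arr s a_oth x == 0) by [].
have := farE l; have := farE r; have := ageE l; have := ageE r.
set L := far _ _ l; set R := far _ _ r; set bl := age _ _ _ l; set br := age _ _ _ r.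
move=> brE blE RE LE.
move=> [L_le R_le] [bl_le br_le] youngE [l_le r_le] next.
have vn : v < n by rewrite lab label_le.
clear nbs farE ageE; clearbody L R bl br.
apply: (wp_assign (v := v)); first by rewrite /= si vE; lia.
apply: (wp_assign (v := l)); first by rewrite /= /upd /= lE; lia.
apply: (wp_assign (v := r)); first by rewrite /= /upd /= rE; lia.
apply: (wp_assign (v := v.+1)); first by rewrite /= /upd /= addn1; repeat split; lia.
apply: (wp_assign (v := L)).
  move: LE; rewrite /= /upd /=.
  by case: eqP => _ /=; rewrite ?muln0 ?muln1 => eqn; repeat split; lia.
apply: (wp_assign (v := R)).
  move: RE; rewrite /= /upd /=.
  by case: eqP => _ /=; rewrite ?muln0 ?muln1 => eqn; repeat split; lia.
apply: (wp_assign (v := bl)).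
  move: blE; rewrite /= /upd /= si.
  by case: eqP => _ /=; rewrite ?muln0 ?muln1 => eqn; repeat split; lia.
apply: (wp_assign (v := br)).
  move: brE; rewrite /= /upd /= si.
  by case: eqP => _ /=; rewrite ?muln0 ?muln1 => eqn; repeat split; lia.
apply: (wp_put (i := L) (v := R)); [by rewrite /= /upd /=; lia..|].
apply: (wp_put (i := R) (v := L)); [by rewrite /= /upd /=; lia..|].
have minE : bl - (bl - br) = minn bl br by rewrite minnE.
apply: (wp_put (i := L) (v := minn bl br)); [by rewrite /= /upd /= ?minE; repeat split; lia..|].
apply: (wp_put (i := R) (v := minn bl br)); [by rewrite /= /upd /= ?minE; repeat split; lia..|].
have maxE : bl + (br - bl) = younger n pos tau i by rewrite -youngE maxnE.
have young_le : younger n pos tau i <= i by rewrite -youngE geq_max bl_le br_le.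
split.
  rewrite /= /upd /= maxE si !modn2.
  by repeat split; try lia; case: odd; case: odd; lia.
rewrite /= /upd /= maxE si !modn2.
have -> : (odd (younger n pos tau i) == odd i :> nat) = (odd (younger n pos tau i) == odd i).
  by do 2 case: odd.
case: (odd _ == odd _) => /=.
  split; first by rewrite /= /upd /= si; repeat split; lia.
  split=> //; first by rewrite /= /upd /= si addn1.
  by case=> [|[|[|[|[|a]]]]] //= _; rewrite /upd /= sin.
by split; [rewrite /= /upd /= si; lia | rewrite /= /upd /= si].
Qed.

End Scan.

(** * The path as listed by its edges *)

Lemma sum_count_mem (T : finType) (s : seq T) : \sum_x count_mem x s = size s.
Proof.
elim: s => [|y s IH] /=; first by rewrite big1.
rewrite big_split /= IH (bigD1 y) //= eqxx big1 ?addn0 // => x /negPf.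
by rewrite eq_sym => ->.
Qed.

(** Summing over all ordered pairs counts each listed edge once in each
    orientation. *)
Lemma edge_list_double (V : finType) (e : rel V) (E : seq (V * V)) :
  edge_list e E -> (size E).*2 = \sum_u \sum_v e u v.
Proof.
move=> Ee; under eq_bigr do under eq_bigr do rewrite -Ee.
under eq_bigr do rewrite big_split; rewrite big_split /=.
rewrite [X in _ + X]exchange_big /= addnn; congr double.
by rewrite pair_big /= -sum_count_mem; apply: eq_bigr => -[].
Qed.

Lemma sum_successor n : \sum_(i < n) \sum_(j < n) (j == i.+1 :> nat) = n.-1.
Proof.
case: n => [|m] /=; first by rewrite big_ord0.
rewrite big_ord_recr /= [X in _ + X]big1 => [|j _]; last by rewrite ltn_eqF // ltn_ord.
rewrite addn0 (eq_bigr (fun=> 1)) ?sum1_card ?card_ord // => i _.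
have im : i.+1 < m.+1 by rewrite ltnS ltn_ord.
rewrite (bigD1 (Ordinal im)) //= eqxx big1 // => j.
by rewrite -val_eqE /= => /negPf ->.
Qed.

Lemma path_edge_count n (V : finType) (e : rel V) (E : seq (V * V)) :
  path_graph n e -> edge_list e E -> size E = n.-1.
Proof.
move=> [p p_bij eE] /edge_list_double.
have -> : \sum_u \sum_v e u v =
    \sum_(i < n) \sum_(j < n) ((j == i.+1 :> nat) + (i == j.+1 :> nat)).
  rewrite (reindex p) /=; last exact: onW_bij.
  apply: eq_bigr => i _; rewrite (reindex p) /=; last exact: onW_bij.
  by apply: eq_bigr => j _; rewrite eE; do 2 case: eqP => //=; lia.
under eq_bigr do rewrite big_split; rewrite big_split /=.
by rewrite [X in _ + X]exchange_big /= !sum_successor addnn => /double_inj.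
Qed.

(** A list is determined up to order by its multiplicities; zeros among [x] and
    [y] are matched by the default value of [nth]. *)
Lemma two_neighbors (r : seq nat) x y : 0 \notin r ->
  (forall c, 0 < c -> count_mem c r = (c == x) + (c == y)) ->
  (nth 0 r 0 = x /\ nth 0 r 1 = y) \/ (nth 0 r 0 = y /\ nth 0 r 1 = x).
Proof.
move=> r0 cnt.
have perm : perm_eq r [seq c <- [:: x; y] | c != 0].
  apply/allP => c; case: (posnP c) => [->|c0] _.
    by rewrite inE (count_memPn r0) (count_memPn _) // mem_filter.
  rewrite inE cnt // count_filter /= !(eq_sym c).
  rewrite lt0n in c0.
  by case: (eqVneq x c) => [->|_]; case: (eqVneq y c) => [->|_]; rewrite ?c0.
have := perm_size perm; move: perm => /=.
case: (eqVneq x 0) => [->|x0]; case: (eqVneq y 0) => [->|y0] /=.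
- by case: r r0 cnt => //; left.
- by case: r r0 cnt => [|c []] //= _ _ /perm_mem /(_ c); rewrite !inE eqxx => /esym /eqP ->; right.
- by case: r r0 cnt => [|c []] //= _ _ /perm_mem /(_ c); rewrite !inE eqxx => /esym /eqP ->; left.
- case: r r0 cnt => [|c [|d []]] //= _ _ P _.
  have := perm_mem P c; rewrite !inE eqxx => /esym /orP[] /eqP E; move: P; rewrite E.
    by rewrite perm_cons => /perm_mem /(_ d); rewrite !inE eqxx => /esym /eqP ->; left.
  rewrite perm_sym -[[:: x; y]]/([:: x] ++ [:: y]) perm_catC /= perm_cons => /perm_mem /(_ d).
  by rewrite !inE eqxx => /eqP ->; right.
Qed.

(** Data indexed by ['I_n] as functions of natural numbers. *)
Definition ext n d (F : 'I_n -> nat) (k : nat) : nat := if insub k is Some i then F i else d.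

Lemma ext_ord n d (F : 'I_n -> nat) (i : 'I_n) : ext d F i = F i.
Proof. by rewrite /ext valK. Qed.

Lemma ext_out n d (F : 'I_n -> nat) k : n <= k -> ext d F k = d.
Proof. by rewrite /ext; case: insubP => // i kn _; rewrite leqNgt kn. Qed.

Section Layout.

Variables (n : nat) (e : rel 'I_n) (f p g pinv : 'I_n -> 'I_n).
Hypotheses (fK : cancel f g) (gK : cancel g f) (pK : cancel p pinv) (pinvK : cancel pinv p).
Hypothesis pathE : forall i j : 'I_n, e (p i) (p j) = (j == i.+1 :> nat) || (i == j.+1 :> nat).

(** Here [p] lists the path, [f] is the sequential function, and [pinv], [g]
    are their inverses.  A label is a vertex increased by one, with label 0 for
    the missing vertices beyond both ends. *)
Definition position (t : nat) : nat := ext 0 (fun i => (pinv (f i)).+1) t.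
Definition turn (q : nat) : nat := if q is k.+1 then ext n (fun i => g (p i) : nat) k else n.
Definition label (q : nat) : nat := if q is k.+1 then ext 0 (fun i => (p i).+1) k else 0.

Lemma turn_ord (i : 'I_n) : turn i.+1 = g (p i).
Proof. exact: ext_ord. Qed.

Lemma label_ord (i : 'I_n) : label i.+1 = (p i).+1.
Proof. exact: ext_ord. Qed.

Lemma turn_lt q : turn q < n -> exists i : 'I_n, q = i.+1.
Proof.
case: q => [|k]; first by rewrite ltnn.
by case: (ltnP k n) => [kn _|/ext_out /= ->]; [exists (Ordinal kn) | rewrite ltnn].
Qed.

Lemma label_pos q : 0 < label q -> exists i : 'I_n, q = i.+1.
Proof.
case: q => [|k] //.
by case: (ltnP k n) => [kn _|/ext_out /= ->]; [exists (Ordinal kn) | ].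
Qed.

Lemma layout_timing : timing n position turn.
Proof.
split=> //.
- move=> t tn; rewrite -[t]/(nat_of_ord (Ordinal tn)) /position ext_ord turn_ord.
  by rewrite pinvK fK.
- by move=> q /turn_lt[i ->]; rewrite turn_ord /position ext_ord gK pK.
- by case=> // q nq; rewrite /= ext_out.
Qed.

Lemma layout_adjacent (i j : 'I_n) : e (f i) (f j) = adjacent (position i) (position j).
Proof.
rewrite -[f i]pinvK -[f j]pinvK pathE /position !ext_ord /adjacent !eqSS.
by [].
Qed.

Lemma label_inj a b : turn a < n -> label a = label b -> a = b.
Proof.
move=> /turn_lt[i ->]; rewrite label_ord => E.
have [j bE] : exists j : 'I_n, b = j.+1 by apply: label_pos; rewrite -E.
by move: E; rewrite bE label_ord => -[/val_inj /(can_inj pK) ->].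
Qed.

Lemma label_gt0 q : turn q < n -> 0 < label q.
Proof. by move=> /turn_lt[i ->]; rewrite label_ord. Qed.

Lemma label_le q : label q <= n.
Proof.
by case: (posnP (label q)) => [-> //|/label_pos[i ->]]; rewrite label_ord.
Qed.

Variable E : seq ('I_n * 'I_n).
Hypothesis Ee : edge_list e E.

(** What the neighbor arrays hold after the first loop, for the vertex colored
    at turn [t]. *)
Lemma neighbor_labels t : t < n ->
  let r := neighbors [seq (val x.1, val x.2) | x <- E] (label (position t)).-1 in
  let q := position t in
  (nth 0 r 0 = label q.-1 /\ nth 0 r 1 = label q.+1) \/
  (nth 0 r 0 = label q.+1 /\ nth 0 r 1 = label q.-1).
Proof.
move=> tn r q; apply: two_neighbors; first exact: zero_neighbors.
case=> // c _; rewrite /r count_neighbors /q.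
have -> : position t = (pinv (f (Ordinal tn))).+1.
  by rewrite -[t]/(nat_of_ord (Ordinal tn)) /position ext_ord.
set i := pinv _; rewrite label_ord !succnK.
case: (ltnP c n) => cn.
- have inj : injective (fun x : 'I_n * 'I_n => (val x.1, val x.2)).
    by move=> [a b] [a' b'] /= [/val_inj -> /val_inj ->].
  set j := pinv (Ordinal cn).
  have cE : c = p j by rewrite /j pinvK.
  have cntE (x y : 'I_n) : count_mem (val x, val y) [seq (val x.1, val x.2) | x <- E]
      = count_mem (x, y) E.
    by rewrite count_map; apply: eq_count => z /=; rewrite (inj_eq inj _ (x, y)).
  have labE k : (c.+1 == label k) = (j.+1 == k).
    apply/eqP/eqP => [ck|<-]; last by rewrite label_ord cE.
    by apply: label_inj; rewrite ?turn_ord // -ck label_ord cE.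
  rewrite !labE cE !cntE Ee pathE.
  by rewrite !eqSS; do 2 case: eqP => //=; lia.
- have out k : (c.+1 == label k) = false.
    by apply/negbTE; have := label_le k; apply: contraL => /eqP <-; rewrite -ltnNge.
  have not_in (x y : nat) : n <= x \/ n <= y ->
      count_mem (x, y) [seq (val x.1, val x.2) | x <- E] = 0.
    move=> xy; apply/count_memPn/mapP => -[[a b] _ [Ex Ey]].
    by have := ltn_ord a; have := ltn_ord b; move: xy; rewrite Ex Ey; lia.
  by rewrite !out (not_in _ _ (or_intror cn)) (not_in _ _ (or_introl cn)).
Qed.

End Layout.

(** * Total correctness and running time *)

Lemma edge_loop_halts n W F s :
  0 < n -> n.+1 <= W -> size F = n.-1 -> (forall x, x \in F -> x.1 < n /\ x.2 < n) ->
  (forall z, arr s a_src z = nth 0 [seq x.1 | x <- F] z) ->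
  (forall z, arr s a_dst z = nth 0 [seq x.2 | x <- F] z) ->
  reading n F s s 0 ->
  halts W edge_loop s (60 * n) (fun s' => reading n F s s' n.-1).
Proof.
move=> n0 nW sF bF src dst start.
pose I m s' := exists2 k, reading n F s s' k & k.+1 + m = n.
have [||||s' [t [ex tB q]]] := @halts_while W
   (Op OpLt (Op OpAdd (Var x_i) (Const 1)) (Var x_n)) read_edge I
   (fun s' => reading n F s s' n.-1) _ _ _ n.-1 s.
- move=> m s' [k [rn ri _ _ _ _ _] km] /=; rewrite rn ri.
  by repeat split; lia.
- move=> m s' [k rd km] /=; rewrite (rd_i rd) (rd_n rd) => stop.
  by have <- : k = n.-1 by lia.
- move=> m s' [k rd km] /=; rewrite (rd_i rd) (rd_n rd) addn1 => go.
  have kn : k.+1 < n by case: ltnP go.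
  exists m.-1; first by lia.
  apply: wp_mono (read_edge_step nW sF bF src dst kn rd) => s1 rd1.
  by exists k.+1 => //; lia.
- by exists 0 => //; lia.
exists s', t; split=> //; apply: leq_trans tB _.
by rewrite prednK //= leq_mul2r; apply/orP; right.
Qed.

Section TurnLoop.

Variables (n : nat) (pos tau lab : nat -> nat) (s0 : state).
Hypothesis tim : timing n pos tau.
Hypothesis lab_inj : forall a b, tau a < n -> lab a = lab b -> a = b.
Hypothesis lab_gt0 : forall q, tau q < n -> 0 < lab q.
Hypothesis lab_le : forall q, lab q <= n.
Hypothesis turnE : forall i, i < n -> (arr s0 a_turn i).+1 = lab (pos i).
Hypothesis neighborE : forall i, i < n ->
  let x := arr s0 a_turn i in
  (arr s0 a_nb1 x = lab (pos i).-1 /\ arr s0 a_nb2 x = lab (pos i).+1) \/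
  (arr s0 a_nb1 x = lab (pos i).+1 /\ arr s0 a_nb2 x = lab (pos i).-1).

Lemma turn_loop_halts W s : n.+1 <= W -> scanning n pos tau lab s0 s 0 ->
  halts W turn_loop s (120 * n.+1) (fun s' => var s' x_n = mismatch n pos tau).
Proof.
move=> nW start; set T := mismatch n pos tau; have Tn : T <= n := mismatch_le _ _ _.
(* The second case is the state after a mismatch, where the loop stops. *)
pose I m s' := (exists i, [/\ scanning n pos tau lab s0 s' i, i <= T & i + m = n])
  \/ (var s' x_n = T /\ var s' x_i = T).
have [||||s' [t [ex tB q]]] := @halts_while W
   (Op OpLt (Var x_i) (Var x_n)) play_turn I (fun s' => var s' x_n = T) _ _ _ n s.
- move=> m s' [[i [[sn si _ _] iT im]]|[sn si]] /=; rewrite sn si; by repeat split; lia.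
- move=> m s' [[i [[sn si _ _] iT im]]|[sn si]] //=; rewrite sn si => stop; lia.
- move=> m s' [[i [sc iT im]]|[sn si]] /=; last by rewrite sn si ltnn.
  rewrite (sc_i sc) (sc_n sc) => go; have i_n : i < n by case: ltnP go.
  exists m.-1; first by lia.
  have step := play_turn_step tim lab_inj lab_gt0 lab_le nW i_n (turnE i_n) (neighborE i_n) sc.
  apply: wp_mono step => s1; case: (ltngtP i T) iT => // [iT|iT] _.
  + rewrite (match_before iT) eqxx => sc1; left; exists i.+1; split=> //; lia.
  + rewrite iT in i_n *; rewrite (mismatch_at i_n) -/T; case: odd => /=; by right.
- by left; exists 0.
exists s', t; split=> //; apply: leq_trans tB _.
by rewrite leq_mul2r; apply/orP; right.
Qed.

End TurnLoop.

Theorem theorem22 :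
  exists (prog : cmd) (C : nat),
    forall (n : nat) (e : rel 'I_n) (f : 'I_n -> 'I_n) (E : seq ('I_n * 'I_n)),
      0 < n -> path_graph n e -> bijective f -> edge_list e E ->
      exists (s : state) (t : nat),
        [/\ exec (n + C) prog (input f E) s t,
            t <= C * n
          & (P_position e f /\ output s = 1) \/ (N_position e f /\ output s = 0)].
Proof.
(* The loops cost at most [60 * n] and [120 * n.+1], the other assignments 8,
   and [n.+1 <= 2 * n]. *)
exists decide, 400 => n e f E n0 path_e [g fK gK] Ee.
have sE := path_edge_count path_e Ee.
case: path_e => p [pinv pK pinvK] pathE.
pose F := [seq (val x.1, val x.2) | x <- E].
pose pos := position f pinv; pose tau := turn p g; pose lab := label p.
have tim : timing n pos tau := layout_timing fK gK pK pinvK.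
have adjE : forall i j : 'I_n, e (f i) (f j) = adjacent (pos i) (pos j) :=
  layout_adjacent f pinvK pathE.
have nW : n.+1 <= n + 400 by lia.
set T := mismatch n pos tau.
suff [s [t [ex tB out]]] : halts (n + 400) decide (input f E) (400 * n)
    (fun s => output s = (T.+1 %% 2)).
  exists s, t; split=> //; rewrite out modn2 /=.
  have PE := P_positionE tim adjE; rewrite -/T in PE.
  by case: (boolP (odd T)) => oT; [right | left]; split=> //;
    [move=> /PE; rewrite oT | apply/PE].
have bF x : x \in F -> x.1 < n /\ x.2 < n.
  by case/mapP => -[a b] _ ->; rewrite !ltn_ord.
have sF : size F = n.-1 by rewrite size_map.
have src z : arr (input f E) a_src z = nth 0 [seq x.1 | x <- F] z.
  by rewrite /= -map_comp.
have dst z : arr (input f E) a_dst z = nth 0 [seq x.2 | x <- F] z.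
  by rewrite /= -map_comp.
have start : reading n F (input f E) (input f E) 0.
  by split=> // z; rewrite ?take0 [LHS]nth_nil ?nth_nil.
have loop1 := edge_loop_halts n0 nW sF bF src dst start.
suff rest s1 : reading n F (input f E) s1 n.-1 ->
    halts (n + 400)
      (Assign x_i (Const 0) ;; turn_loop ;; answer) s1
      (2 + (120 * n.+1 + 6)) (fun s => output s = T.+1 %% 2).
  have [s [t [ex tB out]]] := halts_seq loop1 rest.
  by exists s, t; split=> //; apply: leq_trans tB _; lia.
case=> [rn ri rin r1 r2 ro rb].
set s2 := set_var s1 x_i 0.
apply: halts_seq (_ : halts _ _ _ _ (fun s => s = s2)) _.
  exists s2, 2; split=> //; by apply: (@ExecAssign _ s1 x_i (Const 0) 0); rewrite /= /guard.
move=> _ ->.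
have turnE i : i < n -> (arr s2 a_turn i).+1 = lab (pos i).
  move=> i_n; rewrite /= rin //= (nth_map (Ordinal i_n)) ?size_enum_ord //.
  rewrite -[i]/(nat_of_ord (Ordinal i_n)) nth_ord_enum /pos /position ext_ord.
  by rewrite /lab label_ord pinvK.
have neighborE i : i < n ->
    let x := arr s2 a_turn i in
    (arr s2 a_nb1 x = lab (pos i).-1 /\ arr s2 a_nb2 x = lab (pos i).+1) \/
    (arr s2 a_nb1 x = lab (pos i).+1 /\ arr s2 a_nb2 x = lab (pos i).-1).
  move=> i_n x; rewrite -[arr s2]/(arr s1) r1 r2 -sF take_size.
  have -> : x = (lab (pos i)).-1 by rewrite -turnE.
  exact: (@neighbor_labels _ _ f _ _ _ pK pinvK pathE _ Ee _ i_n).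
have scan0 : scanning n pos tau lab s2 s2 0.
  split=> //; apply: intervals_start => z; by rewrite /= ro rb.
have loop2 := turn_loop_halts tim (@label_inj _ p g _ pK) (@label_gt0 _ p g) (@label_le _ p)
  turnE neighborE nW scan0.
apply: halts_seq loop2 _.
move=> s3 out3.
have [|s4 [t4 [ex4 tB4 out4]]] := @halts_wp (n + 400) answer s3
  (fun s => output s = T.+1 %% 2).
  split=> /=; last by rewrite /output /= /upd /= out3 addn1.
  have Tn : T <= n := mismatch_le _ _ _.
  by rewrite out3 modn2; have := leq_b1 (odd (T + 1)); repeat split; lia.
by exists s4, t4.
Qed.
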